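(* Let $H$ be a Hilbert $C^*$-module and $Q\in\mathcal{L}(H)$ an idempotent. Then $$s(Q)=m(Q)+(I-Q^* )|Q^*|^\dagger+|Q^*|^\dagger(I-Q).$$
   Context: $H$ is a Hilbert module over a $C^*$-algebra, $\mathcal{L}(H)$ the adjointable operators. For $T\in\mathcal{L}(H)$, $|T|=(T^*T)^{1/2}$, and $T^\dagger$ is the Moore–Penrose inverse (unique $X$ with $TXT=T$, $XTX=X$, $(TX)^*=TX$, $(XT)^*=XT$; exists iff $\mathcal{R}(T)$ closed). For an idempotent $Q$, the matched projection is $m(Q)=\tfrac12(|Q^*|+Q^* )|Q^*|^\dagger(|Q^*|+I)^{-1}(|Q^*|+Q)$, and the supplementary projection is $s(Q)=m(2P_{\mathcal{R}(Q)}-Q)$, where $P_{\mathcal{R}(Q)}$ is the projection onto $\mathcal{R}(Q)$. *)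

(* Defs.v *)
(* an abstract unital C*-algebra over C = R[i] (R : realType). *)
From HB Require Import structures.
From mathcomp Require Import all_boot all_order all_algebra.
From mathcomp Require Import complex.
From mathcomp Require Import boolp classical_sets reals.
Set Implicit Arguments. Unset Strict Implicit. Unset Printing Implicit Defensive.
Import Order.TTheory GRing.Theory Num.Theory.
Local Open Scope ring_scope.
Local Open Scope complex_scope.

Section Cstar.
Variable R : realType.
Variable A : algType R[i].
Variables (star : A -> A) (nrm : A -> R).

(* Axioms of a unital C*-algebra (Banach *-algebra with the C*-identity). *)
Record is_Cstar : Prop := IsCstar {
  nrm_eq0 : forall x, nrm x = 0 <-> x = 0;
  nrm_triangle : forall x y, nrm (x + y) <= nrm x + nrm y;
  nrm_scale : forall (c : R[i]) x, (nrm (c *: x))%:C = `|c| * (nrm x)%:C;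
  nrm_submul : forall x y, nrm (x * y) <= nrm x * nrm y;
  nrm_complete : forall u : nat -> A,
    (forall e : R, 0 < e -> exists N, forall m n, (N <= m)%N -> (N <= n)%N ->
        nrm (u m - u n) < e) ->
    exists l, forall e : R, 0 < e -> exists N, forall n, (N <= n)%N ->
        nrm (u n - l) < e;
  star_invol : forall x, star (star x) = x;
  star_add : forall x y, star (x + y) = star x + star y;
  star_scale : forall (c : R[i]) x, star (c *: x) = (c^*)%C *: star x;
  star_mul : forall x y, star (x * y) = star y * star x;
  nrm_Cstar : forall x, nrm (star x * x) = nrm x ^+ 2
}.

(* positive elements: a = b^* b *)
Definition positive (a : A) : Prop := exists b, a = star b * b.

(* |T| = (T^* T)^{1/2}, the unique positive square root *)
Definition absop (T : A) : A :=
  xget 0 [set a | positive a /\ a * a = star T * T].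

(* Moore--Penrose inverse: the unique X with the four Penrose equations *)
Definition mpinv (T : A) : A :=
  xget 0 [set X | T * X * T = T /\ X * T * X = X /\
                  star (T * X) = T * X /\ star (X * T) = X * T].

(* two-sided inverse *)
Definition invop (T : A) : A := xget 0 [set X | X * T = 1 /\ T * X = 1].

(* projection onto R(Q): the projection P with P Q = Q and Q P = P,
   i.e. R(P) = R(Q) *)
Definition rangeproj (Q : A) : A :=
  xget 0 [set P | P * P = P /\ star P = P /\ P * Q = Q /\ Q * P = P].

(* matched projection m(Q) *)
Definition matched (Q : A) : A :=
  let a := absop (star Q) in
  (2%:R^-1 : R[i]) *: ((a + star Q) * mpinv a * invop (a + 1) * (a + Q)).

(* supplementary projection s(Q) = m(2 P_R(Q) - Q) *)
Definition suppl (Q : A) : A := matched (2%:R *: rangeproj Q - Q).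

End Cstar.

(* Main.v *)
From Stdlib Require Import Ncring Ncring_tac.
Require Import Defs.
From HB Require Import structures.
From mathcomp Require Import all_boot all_order all_algebra.
From mathcomp Require Import complex.
From mathcomp Require Import boolp classical_sets reals.
From mathcomp Require Import lra ring.
Import Order.TTheory GRing.Theory Num.Theory.
Local Open Scope ring_scope.

(** Write [a = |Q^*|], [D] for its Moore-Penrose inverse and [P] for the range
projection of [Q].  The idempotent [B = 2 P - Q] satisfies [B B^* = Q Q^*], so
[m(Q)] and [s(Q) = m(B)] are built from the same [a].  With
[E = D (a + 1)^-1 = P E = E P], [al = a + 1] and [be = 1 - Q] this gives
[2 m(Q) = (al - be^* ) E (al - be)] and [2 s(Q) = (al + be^* ) E (al + be)],
whence [s(Q) - m(Q) = be^* E al + al E be = be^* D + D be].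

If [a] or [D] fails to exist, the default value [0] makes both sides vanish;
the range projection and the inverse of [a + 1], however, have to be produced.
[P = Q (Q + Q^* - 1)^-1] exists because [(Q + Q^* - 1)^2 = 1 + k^2] for the
self-adjoint [k = i (Q - Q^* )].  That [1 + c^* c] is invertible is shown first
for small [c], by the Neumann series, and then carried from [c] to [2 c]. *)

Section CstarAlgebra.
Context (R : realType) (A : algType R[i]) (star : A -> A) (nrm : A -> R).
Hypothesis hA : is_Cstar star nrm.
Implicit Types (x y h k a b c : A) (r t : R).

(** Makes the tactic [non_commutative_ring] available in [A]. *)
#[local] Instance alg_ring_ops :
  @Ring_ops A 0 1 (@GRing.add A) (@GRing.mul A)
    (fun x y => x - y) (@GRing.opp A) (@eq A) := {}.

#[local] Instance alg_ring : Ring (Ro := alg_ring_ops).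
Proof.
split; rewrite /equality /eq_notation.
all: try exact: eq_equivalence.
all: try by move=> ? ? -> ? ? ->.
all: try by move=> ? ? ->.
- exact: add0r.
- exact: addrC.
- exact: addrA.
- exact: mul1r.
- exact: mulr1.
- exact: mulrA.
- exact: mulrDl.
- move=> x y z; exact: mulrDr.
- by [].
- exact: subrr.
Qed.

(** * Norm and involution *)

Lemma nrm0 : nrm 0 = 0. Proof. exact/(nrm_eq0 hA). Qed.

Lemma nrmZ_real r x : nrm (r%:C%C *: x) = `|r| * nrm x.
Proof.
apply: (@complexI R); rewrite (nrm_scale hA) normc_def /=.
by rewrite expr0n addr0 sqrtr_sqr rmorphM.
Qed.

Lemma nrmN x : nrm (- x) = nrm x.
Proof.
have -> : - x = (-1)%:C%C *: x by rewrite rmorphN rmorph1 scaleN1r.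
by rewrite nrmZ_real normrN1 mul1r.
Qed.

Lemma nrm_ge0 x : 0 <= nrm x.
Proof. by have := nrm_triangle hA x (- x); rewrite subrr nrm0 nrmN; lra. Qed.

(** The C*-identity and submultiplicativity give [|y|^2 <= |y^*| |y|]; cancel [|y|], then take
    [y = x] and [y = x^*]. *)
Lemma nrm_star x : nrm (star x) = nrm x.
Proof.
have le_star y : nrm y <= nrm (star y).
  have [->|ny] := eqVneq (nrm y) 0; first exact: nrm_ge0.
  have y_gt0 : 0 < nrm y by rewrite lt_neqAle eq_sym ny nrm_ge0.
  rewrite -(ler_pM2r y_gt0) -expr2 -(nrm_Cstar hA); exact: (nrm_submul hA).
by apply/eqP; rewrite eq_le -{2}(star_invol hA x) !le_star.
Qed.

Lemma star0 : star 0 = 0.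
Proof. by apply: (addrI (star 0)); rewrite -(star_add hA) !addr0. Qed.

Lemma starN x : star (- x) = - star x.
Proof. by apply: (addrI (star x)); rewrite -(star_add hA) !subrr star0. Qed.

Lemma starB x y : star (x - y) = star x - star y.
Proof. by rewrite (star_add hA) starN. Qed.

Lemma star1 : star 1 = 1.
Proof.
by have := star_mul hA (star 1) 1; rewrite mulr1 (star_invol hA) mulr1.
Qed.

Lemma starZ_real r x : star (r%:C%C *: x) = r%:C%C *: star x.
Proof. by rewrite (star_scale hA) conjc_real. Qed.

Lemma starZ_i x : star ('i%C *: x) = - ('i%C *: star x).
Proof.
by rewrite (star_scale hA) -scaleNr; congr (_ *: _);
apply/eqP; rewrite eq_complex /= oppr0 !eqxx.
Qed.

Lemma nrm1_le1 : nrm 1 <= 1.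
Proof.
have := nrm_Cstar hA 1; rewrite star1 mulr1 => e.
have := nrm_ge0 1; nra.
Qed.

Lemma nrm_exp x n : nrm (x ^+ n) <= nrm x ^+ n.
Proof.
elim: n => [|n IH]; first by rewrite !expr0 nrm1_le1.
rewrite !exprS; apply: (le_trans (nrm_submul hA _ _)).
by apply: ler_wpM2l => //; exact: nrm_ge0.
Qed.

Lemma mulr_star_eq0 x : x * star x = 0 -> x = 0.
Proof.
move=> e; apply/(nrm_eq0 hA); rewrite -nrm_star; apply/eqP.
by rewrite -sqrf_eq0 -(nrm_Cstar hA) (star_invol hA) e nrm0.
Qed.

(** * Invertible elements *)

Definition invertible x := exists y, y * x = 1 /\ x * y = 1.

Lemma invertibleM x y : invertible x -> invertible y -> invertible (x * y).
Proof.
move=> [u [ux xu]] [v [vy yv]]; exists (v * u); split.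
  by rewrite -mulrA (mulrA u) ux mul1r.
by rewrite -mulrA (mulrA y) yv mul1r.
Qed.

(** [w y] is a left inverse of [x] and, by commutation, [y w] is a right inverse, so the two
    agree. *)
Lemma invertible_comm x y : x * y = y * x -> invertible (x * y) -> invertible x.
Proof.
move=> c [w [wxy xyw]].
have l : (w * y) * x = 1 by rewrite -mulrA -c.
have r' : x * (y * w) = 1 by rewrite mulrA.
suff e : y * w = w * y by exists (y * w); split=> //; rewrite e.
by rewrite -[LHS]mul1r -l -(mulrA _ x) r' mulr1.
Qed.

Lemma invertibleZ (z : R[i]) x : z != 0 -> invertible x -> invertible (z *: x).
Proof.
move=> z0 [u [ux xu]]; exists (z^-1 *: u); split.
  by rewrite -scalerAl -scalerAr scalerA mulVf // scale1r.
by rewrite -scalerAl -scalerAr scalerA mulfV // scale1r.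
Qed.

(* Jacobson: if [w] inverts [1 + x y] then [1 - y w x] inverts [1 + y x]. *)
Lemma invertible_1Dmul_comm x y : invertible (1 + x * y) -> invertible (1 + y * x).
Proof.
move=> [w [wl wr]]; exists (1 - y * w * x); split.
  have -> : (1 - y * w * x) * (1 + y * x) = 1 + y * x - y * (w * (1 + x * y)) * x.
    non_commutative_ring.
  by rewrite wl mulr1 addrK.
have -> : (1 + y * x) * (1 - y * w * x) = 1 + y * x - y * ((1 + x * y) * w) * x.
  non_commutative_ring.
by rewrite wr mulr1 addrK.
Qed.

(** * The Neumann series *)

Lemma exprn_small (q e : R) : 0 <= q -> q < 1 -> 0 < e ->
  exists N : nat, forall n : nat, (N <= n)%N -> q ^+ n < e.
Proof.
move=> q0 q1 e0.
(* A Bernoulli-type bound: [q^n] decays at least like [1 / (n (1 - q))], so the Archimedean property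
   suffices. *)
have bern n : q ^+ n * (1 + n%:R * (1 - q)) <= 1.
  elim: n => [|n IH]; first by rewrite expr0 mul0r addr0 mulr1.
  apply: le_trans IH; rewrite exprSr -mulrA.
  apply: ler_wpM2l; first exact: exprn_ge0.
  rewrite -subr_ge0 -natr1.
  have -> : 1 + n%:R * (1 - q) - q * (1 + (n%:R + 1) * (1 - q))
      = (n%:R + 1) * (1 - q) ^+ 2 by ring.
  by rewrite mulr_ge0 ?sqr_ge0 // natr1.
have [N hN] : exists N : nat, (e * (1 - q))^-1 < N%:R.
  exists (Num.bound ((e * (1 - q))^-1)); apply: le_lt_trans (archi_boundP _).
    exact: lexx.
  by rewrite invr_ge0 mulr_ge0 // ?subr_ge0 ltW.
have ed : 0 < e * (1 - q) by rewrite mulr_gt0 // subr_gt0.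
rewrite -div1r ltr_pdivrMr // in hN.
exists N => n Nn; apply: (@le_lt_trans _ _ (q ^+ N)).
  by apply: ler_wiXn2l => //; exact: ltW.
rewrite ltNge; apply/negP => eN; have := bern N.
have := exprn_ge0 N q0; have := ler0n R N; nra.
Qed.

(** Multiplying by [1 - nrm x] makes the geometric bound telescope, so induction on [k] needs no
    division. *)
Lemma nrm_geometric_tail x (n k : nat) : nrm x < 1 ->
  nrm (\sum_(i < n + k) x ^+ i - \sum_(i < n) x ^+ i) * (1 - nrm x)
    <= nrm x ^+ n - nrm x ^+ (n + k).
Proof.
move=> x1; elim: k => [|k IH]; first by rewrite addn0 !subrr nrm0 mul0r.
rewrite addnS big_ord_recr /= addrAC.
have h1 := nrm_triangle hA (\sum_(i < n + k) x ^+ i - \sum_(i < n) x ^+ i) (x ^+ (n + k)).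
have h2 := nrm_exp x (n + k); rewrite exprSr; nra.
Qed.

Lemma nrm_le_eps_eq0 x (c : R) : (forall e, 0 < e -> nrm x <= c * e) -> x = 0.
Proof.
move=> h; apply/(nrm_eq0 hA)/eqP; rewrite eq_le nrm_ge0 andbT.
rewrite leNgt; apply/negP => x0.
have c1 : 0 < `|c| + 1 by rewrite ltr_wpDl.
(* The sign of [c] is unknown; dividing by [|c| + 1] still yields [c e <= nrm x / 2], which
   contradicts [nrm x > 0]. *)
have := h (nrm x / (`|c| + 1) / 2) _; rewrite !divr_gt0 // => /(_ isT).
apply/negP; rewrite -ltNge; apply: (@le_lt_trans _ _ (nrm x / 2)); last by lra.
rewrite mulrA; apply: ler_wpM2r; first by lra.
rewrite mulrCA; apply: ler_piMr; first exact: ltW.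
rewrite ler_pdivrMr // mul1r; have := ler_norm c; lra.
Qed.

Lemma invertible_1B x : nrm x < 1 -> invertible (1 - x).
Proof.
move=> x1; have x0 := nrm_ge0 x.
pose S n := \sum_(i < n) x ^+ i.
have Sl n : (1 - x) * S n = 1 - x ^+ n.
  by rewrite -opprB mulNr -subrX1 opprB.
have Sr n : S n * (1 - x) = 1 - x ^+ n.
  rewrite -Sl /S mulr_suml mulr_sumr; apply: eq_bigr => i _.
  by rewrite mulrBl mulrBr mul1r mulr1 -exprS -exprSr.
have cauchy e : 0 < e -> exists N : nat, forall m n : nat, (N <= m)%N -> (N <= n)%N ->
    nrm (S m - S n) < e.
  move=> e0; have [|N hN] := exprn_small (nrm x) (e * (1 - nrm x)) x0 x1.
    by rewrite mulr_gt0 // subr_gt0.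
  have tail m n : (N <= n)%N -> (n <= m)%N -> nrm (S m - S n) < e.
    move=> Nn /subnKC <-; rewrite -(@ltr_pM2r _ (1 - nrm x)) ?subr_gt0 // /S.
    have := nrm_geometric_tail x n (m - n) x1.
    have := exprn_ge0 (n + (m - n)) x0; have := hN n Nn; lra.
  exists N => m n Nm Nn; case: (leqP n m) => [|/ltnW] nm; first exact: tail.
  by rewrite -nrmN opprB; exact: tail.
have [l hl] := nrm_complete hA cauchy.
have approx e : 0 < e -> exists n, nrm (S n - l) < e /\ nrm (x ^+ n) < e.
  move=> e0; have [N hN] := hl e e0; have [M hM] := exprn_small _ _ x0 x1 e0.
  exists (maxn N M); split; first by apply: hN; exact: leq_maxl.
  by apply: le_lt_trans (nrm_exp _ _) _; apply: hM; exact: leq_maxr.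
exists l; split; apply/eqP; rewrite -subr_eq0; apply/eqP.
  apply: (nrm_le_eps_eq0 _ (nrm (1 - x) + 1)) => e /approx[n [h1 h2]].
  (* The defect of [l] as an inverse is compared with that of the partial sum [S n], which is
     exactly [x^n]. *)
  have -> : l * (1 - x) - 1 = - ((S n - l) * (1 - x)) - x ^+ n.
    by rewrite mulrBl Sr; non_commutative_ring.
  apply: (le_trans (nrm_triangle hA _ _)); rewrite !nrmN.
  have := nrm_submul hA (S n - l) (1 - x); have := nrm_ge0 (1 - x).
  nra.
apply: (nrm_le_eps_eq0 _ (nrm (1 - x) + 1)) => e /approx[n [h1 h2]].
have -> : (1 - x) * l - 1 = - ((1 - x) * (S n - l)) - x ^+ n.
  by rewrite mulrBr Sl; non_commutative_ring.
apply: (le_trans (nrm_triangle hA _ _)); rewrite !nrmN.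
have := nrm_submul hA (1 - x) (S n - l); have := nrm_ge0 (1 - x).
nra.
Qed.

Lemma invertible_scalarB r x : nrm x < r -> invertible (r%:C%C%:A - x).
Proof.
move=> xr; have r0 : 0 < r := le_lt_trans (nrm_ge0 x) xr.
have rC : (r%:C)%C != 0 :> R[i] by rewrite fmorph_eq0 gt_eqF.
have -> : r%:C%C%:A - x = r%:C%C *: (1 - (r^-1)%:C%C *: x).
  by rewrite scalerBr scalerA -rmorphM mulfV ?gt_eqF // rmorph1 scale1r.
apply: invertibleZ => //; apply: invertible_1B; rewrite nrmZ_real.
by rewrite gtr0_norm ?invr_gt0 // mulrC ltr_pdivrMr // mul1r.
Qed.

(** * Elements [h + i k] and invertibility of [1 + h^2] *)

Lemma mulr_iZ x y : ('i%C *: x) * ('i%C *: y) = - (x * y).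
Proof. by rewrite -scalerAl -scalerAr scalerA -expr2 sqr_i scaleN1r. Qed.

Lemma mul_star_cartesian h k : star h = h -> star k = k -> h * k = k * h ->
  star (h + 'i%C *: k) * (h + 'i%C *: k) = h * h + k * k.
Proof.
move=> sh sk hk; rewrite (star_add hA) starZ_i sh sk mulrDl !mulrDr !mulNr mulr_iZ.
by rewrite -scalerAl -scalerAr hk opprK -!addrA; congr (_ + _); rewrite addrA subrr add0r.
Qed.

Lemma nrm_cartesian h k : star h = h -> star k = k -> h * k = k * h ->
  nrm (h + 'i%C *: k) ^+ 2 = nrm (h * h + k * k).
Proof. by move=> sh sk hk; rewrite -(nrm_Cstar hA) mul_star_cartesian. Qed.

Lemma nrm_scalar r : nrm (r%:C%C%:A) <= `|r|.
Proof. by rewrite nrmZ_real ler_piMr // nrm1_le1. Qed.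

Lemma star_scalar r : star (r%:C%C%:A) = r%:C%C%:A.
Proof. by rewrite starZ_real star1. Qed.

Lemma scalar_comm r x : r%:C%C%:A * x = x * r%:C%C%:A.
Proof. by rewrite mulr_algl mulr_algr. Qed.

Lemma scalarM r t : r%:C%C%:A * t%:C%C%:A = (r * t)%:C%C%:A :> A.
Proof. by rewrite mulr_algl scalerA -rmorphM. Qed.

Lemma scalarD r t : (r + t)%:C%C%:A = r%:C%C%:A + t%:C%C%:A :> A.
Proof. by rewrite rmorphD scalerDl. Qed.

(** With [t = |h|^2], [1 + i h = (1 + t) - (t - i h)] and [|t - i h|^2 = |t^2 + h^2| <= t^2 + t < (1
    + t)^2], so the Neumann series applies. *)
Lemma invertible_1Di h : star h = h -> invertible (1 + 'i%C *: h).
Proof.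
move=> sh; have [t ht t0] : exists2 t, nrm h ^+ 2 = t & 0 <= t.
  by exists (nrm h ^+ 2) => //; exact: sqr_ge0.
have -> : 1 + 'i%C *: h = (1 + t)%:C%C%:A - (t%:C%C%:A + 'i%C *: - h).
  by rewrite scalarD rmorph1 scale1r scalerN; non_commutative_ring.
apply: invertible_scalarB.
have := nrm_cartesian _ _ (star_scalar t) (etrans (starN h) (congr1 -%R sh)) (scalar_comm t (- h)).
set v := nrm (t%:C%C%:A + _) => ev.
have := nrm_triangle hA (t%:C%C%:A * t%:C%C%:A) (- h * - h); rewrite -ev mulrNN scalarM.
have := nrm_scalar (t * t); rewrite ger0_norm ?mulr_ge0 // => h1.
have := nrm_submul hA h h; rewrite -[nrm h * _]expr2 ht => h2 h3.
have := nrm_ge0 (t%:C%C%:A + 'i%C *: - h); rewrite -/v => v0.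
nra.
Qed.

Lemma invertible_1Dsqr h : star h = h -> invertible (1 + h * h).
Proof.
move=> sh; have -> : 1 + h * h = (1 + 'i%C *: h) * (1 + 'i%C *: - h).
  rewrite mulrDl !mulrDr mulr_iZ scalerN !mul1r !mulr1 mulrN opprK.
  by non_commutative_ring.
by apply: invertibleM; apply: invertible_1Di; rewrite ?starN sh.
Qed.

(** * Approximate positivity and invertibility of [1 + c^* c] *)

(* A norm characterisation of positivity of the spectrum (if [h] is
   self-adjoint) that is visibly stable under addition. *)
Definition approx_positive h :=
  forall e : R, 0 < e -> exists2 T, 0 <= T & nrm (T%:C%C%:A - h) <= T + e.

Lemma approx_positiveD h k :
  approx_positive h -> approx_positive k -> approx_positive (h + k).
Proof.
move=> hp kp e e0; have e2 : 0 < e / 2 by lra.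
have [T T0 hT] := hp _ e2; have [S S0 hS] := kp _ e2.
exists (T + S); first exact: addr_ge0.
have -> : (T + S)%:C%C%:A - (h + k) = (T%:C%C%:A - h) + (S%:C%C%:A - k).
  by rewrite scalarD; non_commutative_ring.
apply: le_trans (nrm_triangle hA _ _) _; lra.
Qed.

(** Since [r + h = (r + T) - (T - h)], a bound [|T - h| <= T + r/2] puts this within reach of the
    Neumann series. *)
Lemma invertible_scalarD_approx_positive r h :
  0 < r -> approx_positive h -> invertible (r%:C%C%:A + h).
Proof.
move=> r0 hp; have [|T T0 hT] := hp (r / 2); first by lra.
have -> : r%:C%C%:A + h = (r + T)%:C%C%:A - (T%:C%C%:A - h).
  by rewrite scalarD; non_commutative_ring.
apply: invertible_scalarB; lra.
Qed.

(* [v := T - k^2 + i sqrt(2 T) k] satisfies [v^* v = T^2 + k^4], and [T - k^2]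
   is its real part. *)
Lemma approx_positive_sqr k : star k = k -> approx_positive (k * k).
Proof.
move=> sk e e0; set n := nrm k.
have n0 : 0 <= n by exact: nrm_ge0.
(* Chosen so that [n^4 = T e], hence [|v|^2 <= T^2 + n^4 <= (T + e)^2]. *)
pose T := n ^+ 4 / e; exists T; first by rewrite divr_ge0 ?exprn_ge0 // ltW.
have T0 : 0 <= T by rewrite divr_ge0 ?exprn_ge0 // ltW.
pose s := Num.sqrt (2 * T).
have ss : s * s = 2 * T by rewrite -expr2 sqr_sqrtr // mulr_ge0.
set t : A := T%:C%C%:A; set u : A := s%:C%C%:A.
have tc x : t * x = x * t by exact: scalar_comm.
have uc x : u * x = x * u by exact: scalar_comm.
have ut : u * u = t + t.
  by rewrite scalarM ss -scalarD; congr (_%:C%C%:A); ring.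
pose h := t - k * k; pose l := u * k.
have sh : star h = h by rewrite starB (star_mul hA) sk star_scalar.
have sl : star l = l by rewrite (star_mul hA) sk star_scalar -uc.
have hl : h * l = l * h.
  rewrite /h /l mulrBl mulrBr tc; congr (_ - _).
  by rewrite (mulrA _ u) -uc -!mulrA.
have norm_v := nrm_cartesian _ _ sh sl hl.
set v := h + 'i%C *: l in norm_v.
have star_v : star v = h - 'i%C *: l by rewrite (star_add hA) starZ_i sh sl.
have hl2 : h * h + l * l = t * t + k * k * (k * k).
  have -> : l * l = (t + t) * (k * k).
    by rewrite /l -mulrA (mulrA k) -uc !mulrA ut.
  rewrite /h; have -> : (t - k * k) * (t - k * k) + (t + t) * (k * k)
     = t * t + k * k * (k * k) + (t * (k * k) - k * k * t) by non_commutative_ring.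
  by rewrite (tc (k * k)) subrr addr0.
have h_le : nrm h <= nrm v.
  have := nrm_triangle hA v (star v); rewrite nrm_star star_v.
  have -> : v + (h - 'i%C *: l) = 2%:C%C *: h.
    by rewrite /v addrACA subrr addr0 rmorphD rmorph1 scalerDl scale1r.
  by rewrite nrmZ_real ger0_norm //; lra.
have v_le : nrm v ^+ 2 <= T ^+ 2 + n ^+ 4.
  rewrite norm_v hl2; apply: le_trans (nrm_triangle hA _ _) _; apply: lerD.
    by rewrite scalarM; apply: le_trans (nrm_scalar _) _; rewrite (ger0_norm (mulr_ge0 T0 T0)).
  rewrite -(mulrA k k) (_ : k * (k * (k * k)) = k ^+ 4); last by rewrite !exprS expr0 mulr1.
  exact: nrm_exp.
have Te : n ^+ 4 = T * e by rewrite /T divfK // gt_eqF.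
have v0 := nrm_ge0 v; rewrite -/h; rewrite Te in v_le; nra.
Qed.

(* With [g := (1 + c^* c)^-1] and [x := 3/2 c g] one has
   [x^* x = 9/4 (g - g^2)], so that [1 + x x^*] differs from a sum of
   self-adjoint squares by a positive constant, while
   [4 (1 + x^* x) = (4 - 3 g) (1 + 3 g)] and
   [(4 - 3 g) (1 + c^* c) = 1 + 4 c^* c]. *)
Lemma invertible_quadruple c :
  invertible (1 + star c * c) -> invertible (1 + star (c + c) * (c + c)).
Proof.
set a := star c * c => -[g [ga ag]].
have sa : star a = a by rewrite (star_mul hA) (star_invol hA).
have sg : star g = g.
  have := congr1 star ag; rewrite (star_mul hA) (star_add hA) sa star1 => e.
  by rewrite -[LHS]mulr1 -ag mulrA e mul1r.
have gag : g * a * g = g - g * g.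
  have -> : g * a * g = g * (1 + a) * g - g * g by non_commutative_ring.
  by rewrite ga mul1r.
pose x := (2^-1)%:C%C *: ((1 + 1 + 1) * (c * g)).
have two_x : x + x = (1 + 1 + 1) * (c * g).
  by rewrite /x -scalerDl -rmorphD (_ : 2^-1 + 2^-1 = 1 :> R) ?scale1r //; lra.
have xx : (star x + star x) * (x + x) = (1 + 1 + 1) * (1 + 1 + 1) * (g - g * g).
  rewrite -(star_add hA) two_x !(star_mul hA) !(star_add hA) star1 sg -gag /a.
  by non_commutative_ring.
pose p := x + star x; pose q := 'i%C *: (x - star x); pose w := g + g - 1.
have sp : star p = p by rewrite (star_add hA) (star_invol hA) addrC.
have sq : star q = q by rewrite starZ_i starB (star_invol hA) -scalerN opprB.
have sw : star w = w by rewrite starB (star_add hA) sg star1.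
(* This sum is [8 (p^2 + q^2) + 9 w^2]. As [p^2 + q^2 = 2 (x x^* + x^* x)] and
   [9 w^2 = 9 - 36 (g - g^2) = 9 - 16 x^* x], it equals [16 x x^* + 9]; adding [7] gives
   [16 (1 + x x^* )]. *)
have pos : approx_positive
    ((p + p) * (p + p) + (p + p) * (p + p) + (q + q) * (q + q) + (q + q) * (q + q)
      + (w + w + w) * (w + w + w)).
  have sD y z : star y = y -> star z = z -> star (y + z) = y + z.
    by move=> sy sz; rewrite (star_add hA) sy sz.
  have sp2 := sD _ _ sp sp; have sq2 := sD _ _ sq sq.
  have sw3 := sD _ _ (sD _ _ sw sw) sw.
  by do 4?apply: approx_positiveD; exact: approx_positive_sqr.
have qq : q * q = - ((x - star x) * (x - star x)) by exact: mulr_iZ.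
have inv_xxs : invertible (1 + x * star x).
  have n7 : 0 < 7 :> R by lra.
  have := invertible_scalarD_approx_positive _ _ n7 pos.
  set s := (X in invertible (_ + X)).
  have -> : 7%:C%C%:A + s = 16%:R *: (1 + x * star x).
    have -> : s = (1 + 1 + 1 + 1) * (p * p + p * p + q * q + q * q)
        + (1 + 1 + 1) * (1 + 1 + 1) * (w * w) by rewrite /s; non_commutative_ring.
    rewrite qq rmorph_nat !scaler_nat !mulrS !mulr0n !addr0.
    apply/eqP; rewrite -subr_eq0; apply/eqP.
    transitivity ((1 + 1 + 1 + 1) * ((star x + star x) * (x + x)
      - (1 + 1 + 1) * (1 + 1 + 1) * (g - g * g))).
      by rewrite /p /w; non_commutative_ring.
    by rewrite xx subrr mulr0.
  move=> /(invertibleZ 16%:R^-1); rewrite scalerA mulVf ?scale1r ?pnatr_eq0 //.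
  by apply; rewrite invr_eq0 pnatr_eq0.
have inv_xsx := invertibleZ 4%:R _ _ (invertible_1Dmul_comm _ _ inv_xxs).
have : invertible ((1 + 1 + 1 + 1 - (g + g + g)) * (1 + (g + g + g))).
  have -> : (1 + 1 + 1 + 1 - (g + g + g)) * (1 + (g + g + g))
     = 4%:R *: (1 + star x * x).
    rewrite scaler_nat !mulrS mulr0n addr0.
    transitivity (1 + 1 + 1 + 1 + (star x + star x) * (x + x)).
      by rewrite xx; non_commutative_ring.
    by non_commutative_ring.
  by apply: inv_xsx; rewrite pnatr_eq0.
move=> /invertible_comm h.
have {}h : invertible (1 + 1 + 1 + 1 - (g + g + g)).
  by apply: h; non_commutative_ring.
have -> : 1 + star (c + c) * (c + c) = (1 + 1 + 1 + 1 - (g + g + g)) * (1 + a).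
  transitivity ((1 + 1 + 1 + 1) * (1 + a) - (1 + 1 + 1) * (g * (1 + a))).
    by rewrite ga (star_add hA) /a; non_commutative_ring.
  by non_commutative_ring.
by apply: invertibleM => //; exists g.
Qed.

(** Induction on [n] with [|c| < 2^n]: the base case is the Neumann series, and the step halves [c].
    Since a positive element has the form [b^* b], this inverts [|Q^*| + 1]. *)
Lemma invertible_1Dstar_mul c : invertible (1 + star c * c).
Proof.
have [n] : exists n : nat, nrm c < 2 ^+ n.
  exists (Num.bound (nrm c)); apply: lt_le_trans (archi_boundP (nrm_ge0 c)) _.
  by rewrite -natrX ler_nat ltnW // ltn_expl.
elim: n c => [|n IH] c hc.
  rewrite -[star c * c]opprK; apply: invertible_1B.
  rewrite nrmN (nrm_Cstar hA); have := nrm_ge0 c; rewrite expr0 in hc; nra.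
pose d := (2^-1)%:C%C *: c.
have -> : c = d + d.
  by rewrite -scalerDl -rmorphD (_ : 2^-1 + 2^-1 = 1 :> R) ?scale1r //; lra.
apply: invertible_quadruple; apply: IH; rewrite nrmZ_real.
rewrite exprS in hc; rewrite ger0_norm; lra.
Qed.

(** * Inverse, range projection and Moore-Penrose inverse *)

Lemma invop_spec x : invertible x -> invop x * x = 1 /\ x * invop x = 1.
Proof. exact: (@xgetPex _ 0 [set y | y * x = 1 /\ x * y = 1]). Qed.

Lemma rangeproj_spec Q (P := rangeproj star Q) : Q * Q = Q ->
  [/\ P * P = P, star P = P, P * Q = Q & Q * P = P].
Proof.
move=> QQ.
have [P' hP'] : exists P', P' * P' = P' /\ star P' = P' /\ P' * Q = Q /\ Q * P' = P'.
  set S := star Q.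
  have SS : S * S = S by rewrite -(star_mul hA) QQ.
  pose k := 'i%C *: (Q - S); pose W := Q + S - 1.
  have sk : star k = k by rewrite starZ_i starB (star_invol hA) -scalerN opprB.
  have sW : star W = W by rewrite starB (star_add hA) (star_invol hA) star1 (addrC S).
  have WW : 1 + k * k = W * W.
    rewrite mulr_iZ /W; transitivity (1 - (Q * Q - Q * S - S * Q + S * S)).
      by non_commutative_ring.
    transitivity (Q * Q + Q * S + S * Q + S * S - Q - Q - S - S + 1).
      by rewrite QQ SS; non_commutative_ring.
    by non_commutative_ring.
  have := invertible_1Dsqr _ sk; rewrite WW => /(invertible_comm W W erefl) [V [VW WV]].
  (* The four identities give [Q W = W S] and [W Q = S W], so [V = W^-1] also intertwines [Q] and
     [S]. Hence [Q V] is self-adjoint and [Q V Q = Q S V = Q W V = Q]. *)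
  have QW : Q * W = Q * S.
    by transitivity (Q * Q + Q * S - Q); [rewrite /W|rewrite QQ]; non_commutative_ring.
  have WS : W * S = Q * S.
    by transitivity (Q * S + S * S - S); [rewrite /W|rewrite SS]; non_commutative_ring.
  have WQ : W * Q = S * Q.
    by transitivity (Q * Q + S * Q - Q); [rewrite /W|rewrite QQ]; non_commutative_ring.
  have SW : S * W = S * Q.
    by transitivity (S * Q + S * S - S); [rewrite /W|rewrite SS]; non_commutative_ring.
  have sV : star V = V.
    have := congr1 star WV; rewrite (star_mul hA) sW star1 => e.
    by rewrite -[LHS]mulr1 -WV mulrA e mul1r.
  have QV : Q * V = V * S.
    by rewrite -[LHS]mul1r -VW -[V * S]mulr1 -WV -!mulrA (mulrA W) WQ -SW -!mulrA.
  have VQ : V * Q = S * V.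
    by rewrite -[V * Q]mulr1 -WV -[RHS]mul1r -VW -!mulrA (mulrA W) WS -QW -!mulrA.
  have PQ : Q * V * Q = Q by rewrite -mulrA VQ mulrA -QW -mulrA WV mulr1.
  exists (Q * V); split; first by rewrite mulrA PQ.
  split; first by rewrite (star_mul hA) sV -/S QV.
  by split=> //; rewrite mulrA QQ.
have [] := @xgetPex _ 0 [set P | P * P = P /\ star P = P /\ P * Q = Q /\ Q * P = P]
  (ex_intro _ P' hP').
by move=> ? [? []].
Qed.

(** [a D] and [D a] are the projections onto the ranges of [a] and [a^*], which coincide here;
    algebraically, [D a = a D^*] makes each absorb the other. *)
Lemma mpinv_selfadjoint_comm a D : star a = a -> a * D * a = a ->
  star (a * D) = a * D -> star (D * a) = D * a -> D * a = a * D.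
Proof.
move=> sa ada sad sda.
have aS : a * star D = D * a by rewrite -sda (star_mul hA) sa.
have aSa : a * star D * a = a by have := congr1 star ada; rewrite !(star_mul hA) sa mulrA.
have aD : a * D = D * a * (a * D) by rewrite -aS mulrA aSa.
have Da : a * D = a * D * (D * a) by rewrite -[LHS]sad {1}aD (star_mul hA) sad sda.
by rewrite Da -aS !mulrA ada.
Qed.

(** * The formula for the supplementary projection *)

Lemma suppl_idempotent Q : Q * Q = Q ->
  suppl star Q =
    matched star Q
    + (1 - star Q) * mpinv star (absop star (star Q))
    + mpinv star (absop star (star Q)) * (1 - Q).
Proof.
move=> QQ; set S := star Q.
have [PP sP PQ QP] := rangeproj_spec _ QQ.
rewrite /suppl; set P := rangeproj star Q in PP sP PQ QP *; set B := 2%:R *: P - Q.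
have Bd : B = P + P - Q by rewrite /B scaler_nat.
have PS : P * S = P by have := congr1 star QP; rewrite (star_mul hA) sP.
have sB : star B = P + P - S by rewrite Bd starB (star_add hA) sP.
have BB : star (star B) * star B = star (star Q) * star Q.
  rewrite !(star_invol hA) -/S sB Bd.
  transitivity (P * P + P * P + P * P + P * P - P * S - P * S - Q * P - Q * P + Q * S).
    by non_commutative_ring.
  by rewrite PP PS QP; non_commutative_ring.
have abs_eq : absop star (star B) = absop star S by rewrite /absop BB.
rewrite /matched abs_eq -/S sB.
set a := absop star S; set D := mpinv star a.
(* If [absop] returns its default [0], the Penrose equation [X a X = X] forces [D = 0]. *)
have D0 : a = 0 -> D = 0.
  move=> a0; rewrite /D /mpinv a0; case: xgetP => // X _ [_ [XX _]].
  by rewrite -XX mulr0 mul0r.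
have [/D0->|[ha aa]] : a = 0 \/ positive star a /\ a * a = star S * S.
  by rewrite /a /absop; case: xgetP => [b _ ?|_]; [right|left].
  by rewrite !mulr0 !mul0r !scaler0 !addr0.
have [->|[aDa [DaD [saD sDa]]]] : D = 0 \/ a * D * a = a /\ D * a * D = D /\
    star (a * D) = a * D /\ star (D * a) = D * a.
  by rewrite /D /mpinv; case: xgetP => [X _ ?|_]; [right|left].
  by rewrite !mulr0 !mul0r !scaler0 !addr0.
have [sa inv_a] : star a = a /\ invertible (a + 1).
  case: ha => b ->; rewrite (star_mul hA) (star_invol hA) addrC.
  by split=> //; exact: invertible_1Dstar_mul.
have [] := invop_spec _ inv_a; set I := invop (a + 1) => Ia aI.
have Dc : D * a = a * D := mpinv_selfadjoint_comm _ _ sa aDa saD sDa.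
rewrite (star_invol hA) in aa.
(* Used with [x = a]: [(1 - P) a^2 (1 - P) = (1 - P) Q Q^* (1 - P) = 0], as [P Q = Q]. *)
have vanish x : (1 - P) * x * star ((1 - P) * x) = 0 -> P * x = x.
  by move=> /mulr_star_eq0 /eqP; rewrite mulrBl mul1r subr_eq0 => /eqP.
have Pa : P * a = a.
  apply: vanish; rewrite (star_mul hA) sa mulrA -(mulrA _ a a) aa.
  by rewrite mulrA (mulrBl Q) mul1r PQ subrr !mul0r.
have aP : a * P = a by have := congr1 star Pa; rewrite (star_mul hA) sP sa.
have DDa : D * D * a = D by rewrite -mulrA Dc mulrA.
have DP : D * P = D by rewrite -{1}DDa -mulrA aP.
have PD : P * D = D by rewrite -{1}DaD Dc !mulrA Pa -Dc.
have Ic : D * I = I * D.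
  have c : (a + 1) * D = D * (a + 1) by rewrite mulrDl mulrDr Dc mul1r mulr1.
  by rewrite -[D * I]mul1r -{1}Ia -mulrA (mulrA _ D) c -mulrA aI mulr1.
pose E := D * I.
have EP : E * P = E by rewrite /E Ic -mulrA DP.
have PE : P * E = E by rewrite /E mulrA PD.
have aE : (a + 1) * E = D by rewrite /E Ic mulrA aI mul1r.
have Ea : E * (a + 1) = D by rewrite /E -mulrA Ia mulr1.
clearbody D I.
have -> : (a + S) * D * I * (a + Q) =  (a + S) * E * (a + Q) by rewrite /E !mulrA.
(* Next to [E] the projection [P] acts as [1], so [2 P - Q] can be replaced by [1 + (1 - Q)], and
   likewise for the adjoint. *)
have -> : (a + (P + P - S)) * D * I * (a + B) = (a + 1 + (1 - S)) * E * (a + 1 + (1 - Q)).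
  have -> : (a + (P + P - S)) * D * I = (a + 1 + (1 - S)) * E.
    transitivity (a * E + P * E + P * E - S * E).
      by rewrite /E; non_commutative_ring.
    by rewrite PE; non_commutative_ring.
  have eB : E * (a + B) = E * (a + 1 + (1 - Q)).
    transitivity (E * a + E * P + E * P - E * Q).
      by rewrite Bd; non_commutative_ring.
    by rewrite EP; non_commutative_ring.
  by rewrite -mulrA eB mulrA.
(* The correction terms are doubled to share the factor [1/2]; each cross term then occurs twice in
   the difference of the two products. *)
have half x : x = 2%:R^-1 *: (x + x).
  by rewrite -mulr2n -(scaler_nat 2 x) scalerA mulVf ?scale1r // pnatr_eq0.
rewrite {1}(half ((1 - S) * D)) {1}(half (D * (1 - Q))).
rewrite -!scalerDr; congr (_ *: _).
transitivity ((a + S) * E * (a + Q) + (1 - S) * (E * (a + 1)) + (1 - S) * (E * (a + 1))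
   + (a + 1) * E * (1 - Q) + (a + 1) * E * (1 - Q)).
  by non_commutative_ring.
by rewrite Ea aE !addrA.
Qed.

End CstarAlgebra.

Theorem theorem5p3 (R : realType) (A : algType R[i]) (star : A -> A) (nrm : A -> R)
  (hA : is_Cstar star nrm) (Q : A) (hQ : Q * Q = Q) :
  suppl star Q =
    matched star Q
    + (1 - star Q) * mpinv star (absop star (star Q))
    + mpinv star (absop star (star Q)) * (1 - Q).
Proof. exact: (suppl_idempotent _ _ _ _ hA). Qed.
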